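(* Let $n,k$ be positive integers with $3<n\leq 4k+11$. Let $G$ be a connected planar graph of order $n$ satisfying \[ \delta(G)\ \ge\ \frac{n+k-1}{k+2}. \] Then $G$ has at most $k$ cut-edges.
   Context: All graphs are finite and simple. The order of $G$ is $|V(G)|$, and $\delta(G)$ denotes the minimum vertex degree of $G$. A cut-edge of a connected graph is an edge whose deletion increases the number of connected components. *)

(* Defs.v *)
From HB Require Import structures.
From mathcomp Require Import all_boot all_order all_algebra.
From mathcomp Require Import all_classical all_reals all_analysis.
Import Order.TTheory GRing.Theory Num.Theory.
Import numFieldNormedType.Exports.

Set Implicit Arguments.
Unset Strict Implicit.
Unset Printing Implicit Defensive.

Local Open Scope classical_set_scope.
Local Open Scope ring_scope.

Record sgraph := SGraph {
  vertex :> finType;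
  adj : rel vertex;
  adj_sym : symmetric adj;
  adj_irr : irreflexive adj }.

Definition edges (G : sgraph) : {set {set G}} :=
  [set [set xy.1; xy.2]%SET | xy : G * G & adj xy.1 xy.2].

Definition degree (G : sgraph) (x : G) : nat := #|[set y | adj x y]%SET|.

(* The default value #|G| exceeds every degree, so for nonempty G this is the
   minimum of the degrees; it is 0 for the graph without vertices. *)
Definition min_degree (G : sgraph) : nat :=
  \big[minn/#|G|]_(x : G) degree x.

Definition connected_graph (G : sgraph) : Prop :=
  (0 < #|G|)%N /\ forall x y : G, connect (@adj G) x y.

Definition num_components (G : sgraph) : nat := n_comp (@adj G) [set: G]%SET.

Section DeleteEdge.
Variables (G : sgraph) (f : {set G}).

Definition del_edge_adj : rel G :=
  [rel x y | adj x y && ([set x; y]%SET != f)].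

Lemma del_edge_adj_sym : symmetric del_edge_adj.
Proof. by move=> x y; rewrite /del_edge_adj /= adj_sym finset.setUC. Qed.

Lemma del_edge_adj_irr : irreflexive del_edge_adj.
Proof. by move=> x; rewrite /del_edge_adj /= adj_irr. Qed.

Definition del_edge : sgraph := SGraph del_edge_adj_sym del_edge_adj_irr.

End DeleteEdge.

Definition cut_edges (G : sgraph) : {set {set G}} :=
  [set f in edges G | (num_components G < num_components (del_edge f))%N]%SET.

(* A drawing in the plane R * R: vertices are distinct points; the edge f is
   a simple arc, parametrized on [0, 1] by [arc f], joining the points of its
   two ends; the interior of an arc meets no vertex and no other edge. The
   values of [arc] on sets that are not edges are irrelevant. *)
Record plane_drawing (R : realType) (G : sgraph)
    (pt : G -> R * R) (arc : {set G} -> R -> R * R) : Prop := PlaneDrawing {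
  pt_inj : injective pt;
  arc_continuous : forall f : {set G}, f \in edges G ->
    {within `[0, 1], continuous (arc f)};
  arc_inj : forall f : {set G}, f \in edges G -> {in `[0, 1] &, injective (arc f)};
  arc_ends : forall f : {set G}, f \in edges G ->
    [set arc f 0; arc f 1] = pt @` [set` f];
  arc_vertex : forall (f : {set G}) x, f \in edges G -> ~ (arc f @` `]0, 1[) (pt x);
  arc_disjoint : forall f g : {set G}, f \in edges G -> g \in edges G -> f != g ->
    arc f @` `]0, 1[ `&` arc g @` `]0, 1[ = set0 }.

Definition planar (R : realType) (G : sgraph) : Prop :=
  exists (pt : G -> R * R) (arc : {set G} -> R -> R * R),
    plane_drawing pt arc.

(* Main.v *)
Require Import Defs.
From mathcomp Require Import all_boot all_order all_algebra.
From mathcomp Require Import all_classical all_reals all_analysis.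
From mathcomp Require Import fintype finset fingraph zify.
Import Order.TTheory GRing.Theory Num.Theory.
Local Open Scope ring_scope.

(** The proof counts vertices over the components left by the cut-edges.

    Let [c] be the number of cut-edges and delete all of them. A cut-edge stays
    one after other edges are deleted, so the deletions, made one by one, each
    create a component, and at least [c + 1] components remain
    ([card_cut_edges_lt_n_comp]). Let such a component have [m] vertices and
    receive [s] ends of cut-edges, and let [d >= 2] be at most every degree. A
    vertex has at most [m - 1] neighbours in its component, so if [m <= d] then
    [s >= m * (d - m + 1) >= d]; and if there are at least two components then
    [s >= 1], as the graph is connected. So [(m, s)] dominates, in both
    coordinates, one of the points [(d + 1, 1)] and [(1, d)]. Both are on the
    line [(d - 1) * m + d * s = d ^ 2 + d - 1], hence the left side is at least
    the right side for every component ([component_weight]). The [m] add up to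
    [n] and the [s] to at most [2 * c], so
      [(c + 1) * (d ^ 2 + d - 1) <= (d - 1) * n + d * (2 * c)].
    For [d] the minimum degree this contradicts [n + k - 1 <= d * (k + 2)] if
    [c > k] ([cut_edges_arith]); and [d <= 1] would give [n <= 3]. *)

(** * Arithmetic *)

(** The right side of the conclusion is the value of the left side at the two
    extreme cases [(m, s) = (d + 1, 1)] and [(m, s) = (1, d)]. *)
Lemma component_arith {d m s : nat} :
  (1 < d)%N -> (0 < m)%N -> (0 < s)%N -> (m * d <= m * m.-1 + s)%N ->
  (d ^ 2 + d - 1 <= (d - 1) * m + d * s)%N.
Proof.
move=> d_gt1 m_gt0 s_gt0 deg_le.
have [m_le|m_gt] := leqP m d.
  (* [m * (d - m + 1) - d = (m - 1) * (d - m)] is nonnegative *)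
  have s_ge : (d <= s)%N by nia.
  nia.
nia.
Qed.

Lemma cut_edges_arith {n k c d : nat} :
  (1 < d)%N -> (n + k <= d * (k + 2) + 1)%N ->
  (c.+1 * (d ^ 2 + d - 1) <= (d - 1) * n + d * (2 * c))%N -> (c <= k)%N.
Proof.
move=> d_gt1 deg_ge weight_le; rewrite leqNgt; apply/negP => k_lt.
case: d d_gt1 deg_ge weight_le => [//|[//|d]] _ deg_ge weight_le.
have [j c_eq] : exists j, c = (k.+1 + j)%N by exists (c - k.+1)%N; lia.
subst c; nia.
Qed.

(** * Components of nested relations *)

Section Components.
Set Implicit Arguments.
Unset Strict Implicit.
Local Open Scope nat_scope.
Variable T : finType.
Implicit Types e : rel T.

Lemma n_comp_card_roots e : n_comp e [set: T]%SET = #|roots e|.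
Proof. by apply: eq_card => x; rewrite !inE andbT. Qed.

(** Sending the representative of a component of the smaller relation to that of
    the component of [e] around it is onto, and it identifies the components of
    [u] and [v]. *)
Lemma n_comp_lt_split {e e' : rel T} {u v : T} :
  connect_sym e -> connect_sym e' -> subrel e' (connect e) ->
  connect e u v -> ~~ connect e' u v -> n_comp e [set: T]%SET < n_comp e' [set: T]%SET.
Proof.
move=> syme syme' sub_e'e conn_uv disc_uv.
have root_root' x : root e (root e' x) = root e x.
  apply/esym/eqP; rewrite root_connect //.
  exact: (connect_sub sub_e'e (connect_root e' x)).
rewrite !n_comp_card_roots.
have roots_sub :
    {subset roots e <= [seq root e x | x in [predD1 roots e' & root e' v]]}.
  move=> r /eqP root_r; apply/imageP.
  have [root_rv|neq_rv] := eqVneq (root e' r) (root e' v).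
    (* a component of [e] represented at [v] is represented at [u] too *)
    exists (root e' u).
      rewrite !inE roots_root // andbT.
      by apply: contra disc_uv; rewrite root_connect.
    rewrite root_root' -root_r -(root_root' r) root_rv root_root'.
    by apply/esym/eqP; rewrite root_connect.
  exists (root e' r); first by rewrite !inE roots_root // andbT.
  by rewrite root_root' root_r.
have := leq_trans (subset_leq_card (introT subsetP roots_sub)) (leq_image_card _ _).
have root_v : root e' v \in roots e' by exact: roots_root.
by rewrite (cardD1 (root e' v) (roots e')) root_v.
Qed.

Lemma n_comp_mul_le_sum {e : rel T} {w : T -> nat} {b : nat} :
  (forall r, roots e r -> b <= \sum_(x | root e x == r) w x) -> connect_sym e ->
  n_comp e [set: T]%SET * b <= \sum_x w x.
Proof.
move=> b_le syme.
rewrite (partition_big (root e) (roots e)) => [|x _]; last exact: roots_root.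
rewrite n_comp_card_roots -sum_nat_const.
by apply: leq_sum => r; apply: b_le.
Qed.

End Components.

(** * Deleting a set of edges *)

Section DeleteEdges.
Set Implicit Arguments.
Unset Strict Implicit.
Local Open Scope nat_scope.
Variable G : sgraph.
Implicit Types (F : {set {set G}}) (x y : G).

Definition del_edges_adj F : rel G :=
  [rel x y | adj x y && ([set x; y]%SET \notin F)].

Definition del_degree F x : nat :=
  #|[set y | adj x y & [set x; y]%SET \in F]%SET|.

Lemma del_edges_connect_sym F : connect_sym (del_edges_adj F).
Proof.
by apply: sym_connect_sym => x y; rewrite /del_edges_adj /= adj_sym setUC.
Qed.

Lemma cut_edge_disconnects {f : {set G}} :
  f \in cut_edges G ->
  exists x y, [/\ f = [set x; y]%SET, adj x y & ~~ connect (del_edge_adj f) x y].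
Proof.
rewrite inE => /andP[/imsetP[[x y] /=]]; rewrite inE /= => adj_xy f_xy comp_lt.
exists x, y; split=> //; apply/negP => conn_xy.
have symf := sym_connect_sym (@del_edge_adj_sym G f).
have conn_eq : connect (@adj G) =2 connect (del_edge_adj f).
  move=> a b; apply/idP/idP; apply: connect_sub => {}a {}b.
    move=> adj_ab.
    (* a step along [f] can be replaced by a walk joining its ends *)
    have [ab_f|ab_f] := boolP ([set a; b]%SET == f); last first.
      by apply: connect1; rewrite /del_edge_adj /= adj_ab ab_f.
    have : (a \in f) && (b \in f) by rewrite -(eqP ab_f) !inE !eqxx orbT.
    rewrite f_xy !inE -f_xy => /andP[/orP[] /eqP -> /orP[] /eqP ->];
      by rewrite ?connect0 // symf.
  by move=> /andP[adj_ab _]; apply: connect1.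
by move: comp_lt; rewrite /num_components (eq_n_comp conn_eq) ltnn.
Qed.

(** Induction on [F]: the ends of a cut-edge outside [F] are adjacent after the
    deletion of [F], and no longer connected once it is deleted as well. *)
Lemma card_cut_edges_lt_n_comp {F} :
  0 < #|G| -> F \subset cut_edges G ->
  #|F| < n_comp (del_edges_adj F) [set: G]%SET.
Proof.
move=> /card_gt0P[x0 _].
have [m] := ubnP #|F|; elim: m F => // m IHm F; rewrite ltnS => F_le F_cut.
have [->|[f fF]] := set_0Vmem F.
  rewrite cards0 n_comp_card_roots; apply/card_gt0P.
  exists (root (del_edges_adj set0) x0).
  exact/roots_root/del_edges_connect_sym.
have cardF : #|F| = #|F :\ f|.+1 by rewrite (cardsD1 f) fF.
have F'_lt : #|F :\ f| < n_comp (del_edges_adj (F :\ f)) [set: G]%SET.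
  apply: IHm; first by rewrite -cardF.
  exact: subset_trans (subD1set _ _) F_cut.
rewrite cardF; apply: leq_ltn_trans F'_lt _.
have [u [v [f_uv adj_uv disc_uv]]] := cut_edge_disconnects (subsetP F_cut f fF).
apply: (n_comp_lt_split (u := u) (v := v)).
- exact: del_edges_connect_sym.
- exact: del_edges_connect_sym.
- move=> x y /andP[adj_xy xyNF]; apply: connect1.
  by rewrite /del_edges_adj /= adj_xy in_setD1 negb_and xyNF orbT.
- by apply: connect1; rewrite /del_edges_adj /= adj_uv -f_uv in_setD1 eqxx.
- apply: contra disc_uv; apply: connect_sub => x y /andP[adj_xy xyNF].
  apply: connect1; rewrite /del_edge_adj /= adj_xy.
  by apply: contraNneq xyNF => ->.
Qed.

(** Double counting: the vertex [x] meets at most as many deleted edges as there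
    are members of [F] containing [x], and a member of [F] has two elements. *)
Lemma sum_del_degree_le F : F \subset edges G -> \sum_x del_degree F x <= 2 * #|F|.
Proof.
move=> F_edges.
have del_degree_le x : del_degree F x <= \sum_(f in F) (x \in f).
  rewrite -big_mkcondr sum1_card.
  have star_inj : {in [set y | adj x y & [set x; y]%SET \in F]%SET &,
      injective (fun y => [set x; y]%SET)}.
    move=> y z; rewrite !inE => /andP[adj_xy _] _ eq_yz.
    have : y \in [set x; z]%SET by rewrite -eq_yz !inE eqxx orbT.
    by rewrite !inE => /orP[/eqP y_x|/eqP //]; rewrite y_x adj_irr in adj_xy.
  rewrite /del_degree -(card_in_imset star_inj); apply/subset_leq_card/subsetP => f.
  by case/imsetP => y; rewrite inE => /andP[_ xyF] ->; rewrite unfold_in /= xyF !inE eqxx.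
apply: (@leq_trans (\sum_(x : G) \sum_(f in F) (x \in f))).
  by apply: leq_sum => x _; apply: del_degree_le.
rewrite exchange_big /= mulnC -sum_nat_const; apply: leq_sum => f fF.
rewrite -big_mkcond sum1_card.
have /imsetP[[x y] _ ->] := subsetP F_edges f fF.
by rewrite cards2; case: (_ != _).
Qed.

(** In a component of order [m] a vertex has at most [m - 1] neighbours, the
    others being joined to it by [F]; this gives the degree condition of
    [component_arith]. With no edge of [F] at it the component would be closed
    under adjacency, hence be the whole connected graph. *)
Lemma component_weight {F} {d : nat} {r} :
  connected_graph G -> 1 < d -> (forall x, d <= degree x) ->
  1 < n_comp (del_edges_adj F) [set: G]%SET -> roots (del_edges_adj F) r ->
  d ^ 2 + d - 1 <=
    \sum_(x | root (del_edges_adj F) x == r) (d - 1 + d * del_degree F x).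
Proof.
move=> [_ G_conn] d_gt1 deg_ge comp_gt1 root_r.
set e := del_edges_adj F.
have syme : connect_sym e := del_edges_connect_sym F.
set C := [set x | root e x == r]%SET.
have -> : \sum_(x | root e x == r) (d - 1 + d * del_degree F x) =
    (d - 1) * #|C| + d * \sum_(x in C) del_degree F x.
  rewrite big_split /= -big_distrr /= sum_nat_const mulnC; congr (_ * _ + _ * _).
    by apply: eq_card => x; rewrite !inE.
  by apply: eq_bigl => x; rewrite inE.
have rC : r \in C by rewrite inE; apply: root_r.
have C_gt0 : 0 < #|C| by apply/card_gt0P; exists r.
have same_comp x y : x \in C -> adj x y -> [set x; y]%SET \notin F -> y \in C.
  move=> xC adj_xy xyNF; move: xC; rewrite !inE => /eqP <-.
  by rewrite root_connect // syme; apply: connect1; rewrite /e /del_edges_adj /= adj_xy.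
have deg_le x : x \in C -> degree x <= #|C|.-1 + del_degree F x.
  move=> xC; have -> : #|C|.-1 = #|C :\ x| by rewrite (cardsD1 x C) xC.
  apply: leq_trans (leq_card_setU _ _); apply: subset_leq_card.
  apply/subsetP => y; rewrite !inE => adj_xy; rewrite adj_xy /=.
  have [_|xyNF] := boolP ([set x; y]%SET \in F); first by rewrite orbT.
  have := same_comp x y xC adj_xy xyNF; rewrite inE => ->.
  by rewrite orbF andbT; apply: contraTneq adj_xy => ->; rewrite adj_irr.
apply: component_arith => //; last first.
  apply: (@leq_trans (\sum_(x in C) (#|C|.-1 + del_degree F x))).
    rewrite -sum_nat_const; apply: leq_sum => x xC.
    exact: leq_trans (deg_ge x) (deg_le x xC).
  by rewrite big_split /= sum_nat_const.
rewrite lt0n; apply: contraL comp_gt1; rewrite sum_nat_eq0 => /forall_inP no_F.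
have C_closed : closed (@adj G) (mem C).
  apply: intro_closed; first exact/sym_connect_sym/adj_sym.
  move=> x y adj_xy xC; apply: (same_comp x y) => //.
  have := no_F x xC; rewrite cards_eq0 => /eqP no_Fx.
  by have := in_set0 y; rewrite -no_Fx inE adj_xy /= => ->.
rewrite -leqNgt n_comp_card_roots.
rewrite -(card1 r); apply/subset_leq_card/subsetP => x root_x.
(* every root is in the component of [r], so [r] is the only one *)
have : x \in C by rewrite -(closed_connect C_closed (G_conn r x)).
by rewrite !inE => /eqP <-; rewrite (eqP root_x).
Qed.

End DeleteEdges.

(** * The bound on cut-edges *)

Lemma cut_edges_sub_edges (G : sgraph) : cut_edges G \subset edges G.
Proof. by apply/subsetP => f; rewrite inE => /andP[]. Qed.

Lemma min_degree_le (G : sgraph) (x : G) : (min_degree G <= degree x)%N.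
Proof.
rewrite /min_degree; have := mem_index_enum x.
elim: (index_enum G) => // y s IHs; rewrite in_cons big_cons geq_min.
by move=> /orP[/eqP <-|/IHs ->]; rewrite ?leqnn ?orbT.
Qed.

Theorem theorem1p3 (R : realType) (n k : nat) (G : sgraph)
    (n_gt0 : (0 < n)%N) (k_gt0 : (0 < k)%N)
    (n_bounds : (3 < n <= 4 * k + 11)%N)
    (G_connected : connected_graph G)
    (G_planar : planar R G)
    (G_order : #|G| = n)
    (G_min_degree :
      (n%:R + k%:R - 1) / (k%:R + 2) <= (min_degree G)%:R :> rat) :
  (#|cut_edges G| <= k)%N.
Proof.
have deg_ge : (n + k <= min_degree G * (k + 2) + 1)%N.
  move: G_min_degree; rewrite ler_pdivrMr; last by rewrite -natrD ltr0n addn2.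
  by rewrite lerBlDr -!natrD -natrM natr1 ler_nat addn1.
have deg_gt1 : (1 < min_degree G)%N by nia.
have comp_gt : (#|cut_edges G| < n_comp (del_edges_adj (cut_edges G)) [set: G]%SET)%N.
  by apply: card_cut_edges_lt_n_comp => //; case: G_connected.
rewrite leqNgt; apply/negP => cut_gt.
suff : (#|cut_edges G| <= k)%N by rewrite leqNgt cut_gt.
apply: (cut_edges_arith deg_gt1 deg_ge).
have comp_gt1 : (1 < n_comp (del_edges_adj (cut_edges G)) [set: G]%SET)%N.
  by apply: leq_trans comp_gt; rewrite ltnS (leq_trans _ cut_gt).
apply: leq_trans (leq_mul comp_gt (leqnn _)) _.
apply: leq_trans (n_comp_mul_le_sum _ (del_edges_connect_sym _)) _.
  by move=> r; apply: component_weight => // x; apply: min_degree_le.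
rewrite big_split /= -big_distrr /= sum_nat_const -G_order mulnC leq_add2l leq_mul2l.
by rewrite sum_del_degree_le ?orbT // cut_edges_sub_edges.
Qed.
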